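(* Let $n \ge 1$ be an integer. For any integer $K$ with $1 \le K \le n$, any choice of strata $I_1, \ldots, I_K$ and any allocation scheme $(n_1, \ldots, n_K)$, the stratified sampling estimator $\hat{S}_n^{\mathrm{str}}$ satisfies $$\left( e_2\left( \hat{S}_n^{\mathrm{str}} \right) \right)^2 \;=\; \max_{f \in F}\, \mathrm{var}\left( \hat{S}_n^{\mathrm{str}}(f) \right) \;=\; \frac{1}{4}\, \max_{1 \le k \le K} \frac{w_k^2}{n_k}.$$ The maximal error is attained for a unit step function with a jump at the middle of $I_{k^*}$, where $k^* \in \operatorname{argmax}_{k} w_k^2/n_k$. The minimal value of the maximal (squared) error $\frac{1}{4} \max_k w_k^2/n_k$, over all choices of $K \le n$, of strata and of allocation scheme, is $\frac{1}{4n^2}$, and is obtained with $K = n$ strata of equal lengths ($w_k = n^{-1}$ and $n_k = 1$ for all $k$).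
   Context: Let $F$ be the class of all non-decreasing functions $f : [0,1] \to [0,1]$, and for $f \in F$ let $S(f) = \int_0^1 f(x)\,\mathrm{d}x$. For an estimator $\hat{S}_n$, the worst-case $L^2$ error over $F$ is $e_2(\hat{S}_n) = \sup_{f \in F} \mathbb{E}\left( | S(f) - \hat{S}_n(f) |^2 \right)^{1/2}$. Stratified sampling: a choice of $K$ strata is a choice of points $0 = x_0 < x_1 < \cdots < x_{K-1} < x_K = 1$; the $k$-th stratum is $I_k = [x_{k-1}, x_k]$, with weight (length) $w_k = x_k - x_{k-1}$. An allocation scheme is a tuple of integers $(n_1, \ldots, n_K)$ with $n_k \ge 1$ for all $k$ and $\sum_{k=1}^K n_k = n$. Let $X_{k,i}$, $1 \le k \le K$, $1 \le i \le n_k$, be independent random variables, with $X_{k,i}$ uniformly distributed on $I_k$. The stratified sampling estimator is $$\hat{S}_n^{\mathrm{str}}(f) \;=\; \sum_{k=1}^K w_k \cdot \frac{1}{n_k} \sum_{i=1}^{n_k} f(X_{k,i}).$$ A unit step function is a function of the form $\mathbf{1}_{[x_*, 1]}$ (indicator function on $[0,1]$), with jump at $x_* \in [0,1]$. *)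

(* Defs.v *)
From HB Require Import structures.
From mathcomp Require Export all_boot all_order all_algebra.
From mathcomp Require Export all_classical all_reals all_analysis.
Set Implicit Arguments.
Unset Strict Implicit.
Unset Printing Implicit Defensive.
Export Order.TTheory GRing.Theory Num.Theory.
Export numFieldNormedType.Exports.

Local Open Scope classical_set_scope.
Local Open Scope ring_scope.

Definition is_maximum (disp : Order.disp_t) (V : porderType disp) (A : set V)
  (v : V) : Prop := A v /\ ubound A v.

Definition is_minimum (disp : Order.disp_t) (V : porderType disp) (A : set V)
  (v : V) : Prop := A v /\ lbound A v.

(* Functions [0,1] -> [0,1] are represented by functions R -> R of which only
   the values on [0,1] are ever used. *)
Definition monotone_class (R : realType) : set (R -> R) :=
  [set f | {in `[0, 1] &, {homo f : x y / x <= y}} /\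
           {in `[0, 1], forall x, f x \in `[0, 1]}].

Definition unit_step (R : realType) (a : R) : R -> R := \1_(`[a, 1]).

Definition true_integral (R : realType) (f : R -> R) : R :=
  \int[@lebesgue_measure R]_(x in `[0, 1]) f x.

(* Only x 0, ..., x K matter; for k < K, the stratum of index k is
   [x k, x k.+1], so that indices are shifted by one. *)
Definition is_strata (R : realType) (K : nat) (x : nat -> R) : Prop :=
  [/\ x 0%N = 0, x K = 1 & forall k, (k < K)%N -> x k < x k.+1].

Definition weight (R : realType) (x : nat -> R) (k : nat) : R := x k.+1 - x k.

Definition midpoint (R : realType) (x : nat -> R) (k : nat) : R :=
  (x k + x k.+1) / 2.

Definition is_allocation (n K : nat) (m : 'I_K -> nat) : Prop :=
  (forall k, (1 <= m k)%N) /\ (\sum_(k < K) m k)%N = n.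

Definition stratum_ratio (R : realType) (K : nat) (x : nat -> R)
  (m : 'I_K -> nat) (k : 'I_K) : R := weight x k ^+ 2 / (m k)%:R.

(* The ratios are nonnegative, so the default value 0 does not affect the
   maximum when K > 0. *)
Definition max_sq_error (R : realType) (K : nat) (x : nat -> R)
  (m : 'I_K -> nat) : R :=
  4^-1 * \big[Num.max/0]_(k < K) stratum_ratio x m k.

Definition uniform_on (d : measure_display) (T : measurableType d)
  (R : realType) (P : probability T R) (a b : R) (Y : {RV P >-> R}) : Prop :=
  exists ab : a < b, forall A : set R, measurable A ->
    distribution P Y A = uniform_prob ab A.

Definition independent_RVs (d : measure_display) (T : measurableType d)
  (R : realType) (P : probability T R) (I : finType) (Y : I -> {RV P >-> R}) :
  Prop :=
  forall (J : {set I}) (B : I -> set R), (forall i, measurable (B i)) ->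
    P (\bigcap_(i in [set` J]) (Y i @^-1` B i)) =
    (\prod_(i in J) P (Y i @^-1` B i))%E.

Definition is_stratified_sample (d : measure_display) (T : measurableType d)
  (R : realType) (P : probability T R) (K : nat) (x : nat -> R)
  (m : 'I_K -> nat) (X : forall k : 'I_K, 'I_(m k) -> {RV P >-> R}) : Prop :=
  (forall (k : 'I_K) (i : 'I_(m k)), uniform_on (x k) (x k.+1) (X k i)) /\
  independent_RVs (fun j : {k : 'I_K & 'I_(m k)} => X (tag j) (tagged j)).

(* The sample points lie in [0,1] only almost surely: f is extended by 0
   outside [0,1], where its values are meaningless. *)
Definition strat_estimator (d : measure_display) (T : measurableType d)
  (R : realType) (P : probability T R) (K : nat) (x : nat -> R)
  (m : 'I_K -> nat) (X : forall k : 'I_K, 'I_(m k) -> {RV P >-> R})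
  (f : R -> R) : T -> R := fun t =>
  \sum_(k < K) weight x k * ((m k)%:R^-1 *
    \sum_(i < m k) (f \_ `[0, 1]) (X k i t)).

Definition L2_error (d : measure_display) (T : measurableType d)
  (R : realType) (P : probability T R) (Shat : (R -> R) -> T -> R)
  (f : R -> R) : \bar R :=
  (('E_P[(fun t => `|true_integral f - Shat f t| ^+ 2)%R]) `^ 2^-1)%E.

Definition e2 (d : measure_display) (T : measurableType d)
  (R : realType) (P : probability T R) (Shat : (R -> R) -> T -> R) : \bar R :=
  ereal_sup [set L2_error P Shat f | f in @monotone_class R].

(* Main.v *)
From HB Require Import structures.
Require Import Defs.
From mathcomp Require Import measurable_realfun.
Set Implicit Arguments.
Unset Strict Implicit.
Unset Printing Implicit Defensive.

(** The estimator is unbiased: a sample in the stratum k has as mean the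
average of f over that stratum ([sample_mean]), and the averages weighted by
the lengths add up to the integral of f ([strat_estimator_unbiased]).  Hence
the mean square error is the variance and, the samples being independent, it
is the sum over all samples of (w_k / n_k)^2 times the variance of f at that
sample, that is
[[
  sum_k (w_k^2 / n_k) * Var f(X_k)        (X_k uniform on the stratum k).
]]
On the stratum k, a non-decreasing f varies between its values a_k and b_k at
the two ends, so that Var f(X_k) <= ((b_k - a_k) / 2)^2 by Popoviciu's
inequality ([sample_variance_le]).  The jumps b_k - a_k lie in [0,1] and their
sum telescopes to f 1 - f 0 <= 1, so the sum of their squares is at most 1:
the mean square error is at most a quarter of the largest w_k^2 / n_k
([mean_square_error_le]).  For the unit step at the middle of a stratum k where
this ratio is largest, f(X_k) is a fair coin, of variance 1/4, so the bound is
attained ([mean_square_error_unit_step]); the supremum defining the worst-case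
error is therefore a maximum and equals the square root of that bound
([e2_strat_estimator]).

For the optimal choice of strata, let M be the largest ratio.  Then
w_k <= sqrt (M n_k) <= sqrt M * n_k, and summing over k gives
1 <= sqrt M * n ([max_sq_error_ge]).  Equal strata with one sample each turn
this into an equality.

Every random variable involved is a bounded measurable function of the
samples, so all expectations are finite and real-valued integrals suffice. *)

Local Open Scope classical_set_scope.
Local Open Scope ring_scope.

(** * Bounded measurable functions *)

Definition bounded_measurable (d : measure_display) (T : measurableType d)
  (R : realType) (f : T -> R) : Prop :=
  measurable_fun setT f /\ exists M : R, forall t, `|f t| <= M.

Section bounded_measurable_theory.
Context (d : measure_display) (T : measurableType d) (R : realType).
Implicit Types f g : T -> R.

Lemma bounded_measurable_cst (c : R) : bounded_measurable (fun _ : T => c).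
Proof. by split; [exact: measurable_cst|exists `|c|]. Qed.

Lemma bounded_measurableD f g : bounded_measurable f -> bounded_measurable g ->
  bounded_measurable (fun t => f t + g t).
Proof.
move=> [mf [M fM]] [mg [N gN]]; split; first exact: measurable_funD.
by exists (M + N) => t; rewrite (le_trans (ler_normD _ _))// lerD.
Qed.

Lemma bounded_measurableM f g : bounded_measurable f -> bounded_measurable g ->
  bounded_measurable (fun t => f t * g t).
Proof.
move=> [mf [M fM]] [mg [N gN]]; split; first exact: measurable_funM.
by exists (M * N) => t; rewrite normrM ler_pM.
Qed.

Lemma bounded_measurableB f g : bounded_measurable f -> bounded_measurable g ->
  bounded_measurable (fun t => f t - g t).
Proof.
move=> [mf [M fM]] [mg [N gN]]; split; first exact: measurable_funB.
by exists (M + N) => t; rewrite (le_trans (ler_normB _ _))// lerD.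
Qed.

Lemma bounded_measurableX2 f : bounded_measurable f ->
  bounded_measurable (fun t => f t ^+ 2).
Proof. by move=> bf; exact: (bounded_measurableM bf bf). Qed.

Lemma bounded_measurable_sum (I : finType) (f : I -> T -> R) :
  (forall i, bounded_measurable (f i)) ->
  bounded_measurable (fun t => \sum_i f i t).
Proof.
move=> bf; have -> : (fun t => \sum_i f i t) = \sum_i f i.
  by apply/funext => t; rewrite fct_sumE.
apply: (big_ind (@bounded_measurable d T R)).
- exact: bounded_measurable_cst.
- by move=> g h bg bh; exact: (bounded_measurableD bg bh).
- by move=> i _; exact: bf.
Qed.

Lemma bounded_measurable_comp d' (T' : measurableType d') (Y : T' -> T) f :
  measurable_fun setT Y -> bounded_measurable f ->
  bounded_measurable (fun t => f (Y t)).
Proof.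
move=> mY [mf [M fM]]; split; first exact: measurableT_comp.
by exists M => t; exact: fM.
Qed.

Lemma bounded_measurable_integrable (mu : {measure set T -> \bar R}) D f :
  measurable D -> (mu D < +oo)%E -> bounded_measurable f ->
  mu.-integrable D (EFin \o f).
Proof.
move=> mD muD [mf [M fM]]; apply: measurable_bounded_integrable => //.
  exact: measurable_funTS.
exists M; split; first exact: num_real.
by move=> N MN t _; exact: le_trans (fM t) (ltW MN).
Qed.

End bounded_measurable_theory.

(** * Moments of bounded random variables *)

Section probability_calculus.
Context (d : measure_display) (T : measurableType d) (R : realType).
Variable P : probability T R.
Implicit Types f g : T -> R.

Lemma bounded_measurable_integrableP f : bounded_measurable f ->
  P.-integrable setT (EFin \o f).
Proof.
move=> bf; apply: bounded_measurable_integrable => //.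
by apply: fin_num_fun_lty; exact: fin_num_measure.
Qed.
Local Notation bmi := bounded_measurable_integrableP.

Lemma Rintegral_probability_cst (c : R) : \int[P]_t c = c.
Proof. by rewrite Rintegral_cst//= probability_setT mulr1. Qed.

Lemma expectation_Rintegral f : bounded_measurable f ->
  'E_P[f]%E = (\int[P]_t f t)%:E.
Proof.
move=> bf; rewrite unlock /Rintegral fineK//.
exact/integrable_fin_num/bmi.
Qed.

Lemma variance_Rintegral f : bounded_measurable f ->
  'V_P[f]%E = (\int[P]_t (f t - \int[P]_s f s) ^+ 2)%:E.
Proof.
move=> bf; rewrite /variance unlock (expectation_Rintegral bf).
have bfc := bounded_measurableB bf (bounded_measurable_cst T (\int[P]_s f s)).
exact: (expectation_Rintegral (bounded_measurableM bfc bfc)).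
Qed.

Lemma Rintegral_sum (I : finType) (f : I -> T -> R) :
  (forall i, bounded_measurable (f i)) ->
  \int[P]_t (\sum_i f i t) = \sum_i \int[P]_t f i t.
Proof.
move=> bf.
suff H : forall s : seq I, bounded_measurable (fun t => \sum_(i <- s) f i t) /\
    \int[P]_t (\sum_(i <- s) f i t) = \sum_(i <- s) \int[P]_t f i t.
  exact: (H _).2.
elim => [|i s [bs IH]]; split.
- by under eq_fun do rewrite big_nil; exact: bounded_measurable_cst.
- under eq_Rintegral do rewrite big_nil.
  by rewrite big_nil Rintegral_probability_cst.
- by under eq_fun do rewrite big_cons; exact: (bounded_measurableD (bf i) bs).
- under eq_Rintegral do rewrite big_cons.
  rewrite big_cons RintegralD//; [by rewrite IH|exact: bmi (bf i)|exact: bmi bs].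
Qed.

(** The Koenig-Huygens formula.  Taking for c the middle of the range of f,
it gives Popoviciu's inequality, and also the variance of a fair coin. *)
Lemma variance_about f (c : R) : bounded_measurable f ->
  \int[P]_t (f t - \int[P]_s f s) ^+ 2 =
  \int[P]_t (f t - c) ^+ 2 - (\int[P]_t f t - c) ^+ 2.
Proof.
move=> bf; set e := \int[P]_t f t; pose u t := f t - c; pose b := e - c.
have bc := @bounded_measurable_cst d T R.
have bu : bounded_measurable u by exact: (bounded_measurableB bf (bc c)).
have bu2 := bounded_measurableX2 bu.
have b2u : bounded_measurable (fun t => b *+ 2 * u t).
  exact: (bounded_measurableM (bc _) bu).
have eu : \int[P]_t u t = b.
  by rewrite RintegralB ?Rintegral_probability_cst//; exact: bmi.
transitivity (\int[P]_t (u t ^+ 2 - b *+ 2 * u t + b ^+ 2)).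
  apply: eq_Rintegral => t _.
  have -> : f t - e = u t - b by rewrite /u /b opprB addrA subrK.
  by rewrite sqrrB mulrnAl [b * _]mulrC.
rewrite RintegralD//; [|exact: bmi (bounded_measurableB bu2 b2u)|exact: bmi].
rewrite RintegralB//; [|exact: bmi|exact: bmi].
rewrite RintegralZl//; last exact: bmi.
by rewrite Rintegral_probability_cst eu -/b mulrnAl -expr2 mulr2n opprD addrA subrK.
Qed.

(** Pythagoras in L^2: expanding the square leaves the diagonal terms only. *)
Lemma Rintegral_sqr_sum_orthogonal (I : finType) (U : I -> T -> R) :
  (forall i, bounded_measurable (U i)) ->
  (forall i j, i != j -> \int[P]_t (U i t * U j t) = 0) ->
  \int[P]_t (\sum_i U i t) ^+ 2 = \sum_i \int[P]_t U i t ^+ 2.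
Proof.
move=> bU U0.
under eq_Rintegral do rewrite expr2 big_distrlr/=.
rewrite Rintegral_sum; last first.
  move=> i; apply: bounded_measurable_sum => j; exact: bounded_measurableM.
apply: eq_bigr => i _; rewrite Rintegral_sum; last first.
  by move=> j; exact: bounded_measurableM.
rewrite (bigD1 i)//= big1 ?addr0// => j ji; apply: U0.
by rewrite eq_sym.
Qed.

End probability_calculus.

(** * Independent samples *)

Lemma integral_distribution_bounded (d d' : measure_display)
  (T : measurableType d) (T' : measurableType d') (R : realType)
  (P : probability T R) (Z : {RV P >-> T'}) (k : T' -> R) :
  bounded_measurable k ->
  (\int[distribution P Z]_y (k y)%:E = (\int[P]_t k (Z t))%:E)%E.
Proof.
move=> bk.
have bkZ : bounded_measurable (k \o Z).
  by apply: bounded_measurable_comp => //; exact: measurable_funPT.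
rewrite integral_distribution//; last 2 first.
- by apply/measurable_EFinP; exact: bk.1.
- exact: (bounded_measurable_integrableP P bkZ).
by rewrite /Rintegral fineK//; apply: integrable_fin_num => //;
  exact: (bounded_measurable_integrableP P bkZ).
Qed.

(** Independence says that the law of the pair (X, Y) and the product of the
laws of X and Y agree on rectangles.  Hence they are equal, and the
expectation of the product is computed by Fubini's theorem. *)
Lemma Rintegral_mul_independent (d : measure_display) (T : measurableType d)
  (R : realType) (P : probability T R) (X Y : {RV P >-> R}) (f g : R -> R) :
  (forall A B, measurable A -> measurable B ->
    P (X @^-1` A `&` Y @^-1` B) = (P (X @^-1` A) * P (Y @^-1` B))%E) ->
  bounded_measurable f -> bounded_measurable g ->
  \int[P]_t (f (X t) * g (Y t)) = (\int[P]_t f (X t)) * \int[P]_t g (Y t).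
Proof.
move=> ind bf bg.
have mXY : measurable_fun setT (fun t => (X t, Y t)).
  by apply: measurable_fun_pair; exact: measurable_funPT.
pose XY : {mfun T >-> (R * R)%type} :=
  HB.pack (fun t => (X t, Y t)) (isMeasurableFun.Build _ _ _ _ _ mXY).
pose m1 := distribution P X; pose m2 := distribution P Y.
pose h (z : R * R) := f z.1 * g z.2.
have bh : bounded_measurable h.
  apply: bounded_measurableM.
    exact: (bounded_measurable_comp measurable_fst bf).
  exact: (bounded_measurable_comp measurable_snd bg).
have joint D : measurable D -> (m1 \x m2)%E D = distribution P XY D.
  by apply: product_measure_unique => A B mA mB; exact: ind.
have hm : (m1 \x m2)%E.-integrable setT (EFin \o h).
  apply: bounded_measurable_integrable => //.
  rewrite [ltLHS](joint setT measurableT).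
  by apply: fin_num_fun_lty; exact: fin_num_measure.
have int_gY : m2.-integrable setT (EFin \o g).
  exact: bounded_measurable_integrableP.
apply: EFin_inj; rewrite EFinM -!integral_distribution_bounded// -/m1 -/m2.
rewrite -[LHS](integral_distribution_bounded XY bh).
transitivity (\int[m1 \x m2]_z (h z)%:E)%E.
  by apply: eq_measure_integral => A mA _; exact/esym/joint.
rewrite -integral12_prod_meas1// /fubini_F/=.
under eq_integral => x _.
  rewrite (_ : (fun y => (f x * g y)%:E) = (fun y => (f x)%:E * (EFin \o g) y)%E)//.
  rewrite integralZl//.
  over.
rewrite /= integral_distribution_bounded//.
by rewrite -integralZr//; exact: bounded_measurable_integrableP.
Qed.

Lemma independent_RVs_pair (d : measure_display) (T : measurableType d)
  (R : realType) (P : probability T R) (I : finType) (Y : I -> {RV P >-> R})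
  (i j : I) : independent_RVs Y -> i != j ->
  forall A B, measurable A -> measurable B ->
    P (Y i @^-1` A `&` Y j @^-1` B) = (P (Y i @^-1` A) * P (Y j @^-1` B))%E.
Proof.
move=> indY ij A B mA mB.
pose D k := if k == i then A else B.
have mD k : measurable (D k) by rewrite /D; case: ifP.
have := indY [set i; j]%SET D mD.
rewrite big_setU1/= ?inE// big_set1 /D eqxx [j == i]eq_sym (negbTE ij) => <-.
congr (P _); apply/seteqP; split => t /=.
  move=> [At Bt] k /=; rewrite !inE => /orP[] /eqP ->; first by rewrite eqxx.
  by rewrite eq_sym (negbTE ij).
move=> ABt; split.
  by have := ABt i; rewrite /= !inE !eqxx => /(_ isT).
by have := ABt j; rewrite /= !inE !eqxx orbT [j == i]eq_sym (negbTE ij) => /(_ isT).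
Qed.

(** Bienayme's formula: the centered terms are pairwise orthogonal because
they are independent with mean zero. *)
Lemma mean_square_error_independent (d : measure_display)
  (T : measurableType d) (R : realType) (P : probability T R) (I : finType)
  (Y : I -> {RV P >-> R}) (c : I -> R) (g : R -> R) :
  independent_RVs Y -> bounded_measurable g ->
  \int[P]_t (\sum_i c i * g (Y i t) - \sum_i c i * \int[P]_s g (Y i s)) ^+ 2 =
  \sum_i c i ^+ 2 * \int[P]_t (g (Y i t) - \int[P]_s g (Y i s)) ^+ 2.
Proof.
move=> indY bg.
pose e i := \int[P]_s g (Y i s).
have bgY i : bounded_measurable (fun t => g (Y i t)).
  by apply: bounded_measurable_comp => //; exact: measurable_funPT.
have bcst := @bounded_measurable_cst _ T R.
have bgYe i : bounded_measurable (fun t => g (Y i t) - e i).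
  exact: (bounded_measurableB (bgY i) (bcst _)).
have bU i : bounded_measurable (fun t => c i * (g (Y i t) - e i)).
  exact: (bounded_measurableM (bcst _) (bgYe i)).
transitivity (\int[P]_t (\sum_i c i * (g (Y i t) - e i)) ^+ 2).
  by apply: eq_Rintegral => t _; under [in RHS]eq_bigr do rewrite mulrBr;
    rewrite sumrB.
rewrite Rintegral_sqr_sum_orthogonal//.
  apply: eq_bigr => i _; under eq_Rintegral do rewrite exprMn.
  rewrite RintegralZl//.
  exact: (bounded_measurable_integrableP P (bounded_measurableX2 (bgYe i))).
move=> i j ij.
have centered k : \int[P]_t (c k * (g (Y k t) - e k)) = 0.
  have bY := bounded_measurable_integrableP P (bgY k).
  rewrite RintegralZl//; last exact: (bounded_measurable_integrableP P (bgYe k)).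
  rewrite RintegralB// ?Rintegral_probability_cst ?subrr ?mulr0//.
  exact: (bounded_measurable_integrableP P (bcst _)).
have bh k : bounded_measurable (fun y => c k * (g y - e k)).
  have bc := @bounded_measurable_cst _ (measurableTypeR R) R.
  exact: (bounded_measurableM (bc _) (bounded_measurableB bg (bc _))).
have := Rintegral_mul_independent (independent_RVs_pair indY ij) (bh i) (bh j).
by rewrite /= centered mul0r.
Qed.

(** * Uniform samples and monotone functions *)

(** The laws of random variables live on R with its default measurable
structure, the Lebesgue measure on [measurableTypeR R].  The measurable sets
are the same, but the two structures carry different displays; this lemma
passes from the first to the second. *)
Lemma bounded_measurable_lebesgue (R : realType) (h : R -> R) :
  bounded_measurable h -> bounded_measurable (h : measurableTypeR R -> R).
Proof. by []. Qed.

Lemma integrable_lebesgue_itv (R : realType) (h : R -> R) (a b : R)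
  (l r : bool) : bounded_measurable h ->
  (@lebesgue_measure R).-integrable [set` Interval (BSide l a) (BSide r b)]
    (EFin \o h).
Proof.
move=> /bounded_measurable_lebesgue bh.
apply: bounded_measurable_integrable => //.
by rewrite /= lebesgue_measure_itv/=; case: ifP => _; rewrite -?EFinB ltry.
Qed.

Lemma Rintegral_uniform_on (d : measure_display) (T : measurableType d)
  (R : realType) (P : probability T R) (a b : R) (Y : {RV P >-> R})
  (h : R -> R) :
  uniform_on a b Y -> bounded_measurable h -> (forall y, 0 <= h y) ->
  \int[P]_t h (Y t) =
  (b - a)^-1 * \int[@lebesgue_measure R]_(y in `[a, b]) h y.
Proof.
move=> [ab dY] bh h0; apply: EFin_inj.
have mY : measurable_fun setT (Y : T -> measurableTypeR R).
  by move=> mT A mA; exact: (measurable_funPT Y mT A mA).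
(* Y seen with values in the measurable type that carries uniform_prob. *)
pose Y' : {RV P >-> measurableTypeR R} :=
  HB.pack (Y : T -> measurableTypeR R) (isMeasurableFun.Build _ _ _ _ _ mY).
have bh' := bounded_measurable_lebesgue bh.
rewrite -[LHS](integral_distribution_bounded Y' bh').
transitivity (\int[uniform_prob ab]_y (h y)%:E)%E.
  by apply: eq_measure_integral => A mA _; exact: dY.
rewrite integral_uniform//; last by apply/measurable_EFinP; exact: bh'.1.
rewrite EFinM /Rintegral fineK//; apply: integrable_fin_num => //.
exact: integrable_lebesgue_itv.
Qed.

(** Outside [0,1] the function f is arbitrary; composed with the projection
onto [0,1] it is monotone on the whole line, hence measurable. *)
Lemma monotone_class_bounded_measurable (R : realType) (f : R -> R) :
  monotone_class f -> bounded_measurable (f \_ `[0, 1]).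
Proof.
move=> [f_nd f01].
have clamp01 (y : R) : Num.max 0 (Num.min y 1) \in `[0, 1].
  by rewrite in_itv/= le_max lexx ge_max ler01 ge_min lexx orbT.
have mI : measurable (`[0, 1]%classic : set R) by [].
split.
  apply: (iffLR (measurable_restrictT f mI)).
  apply: (@eq_measurable_fun _ _ R R _ (fun y : R => f (Num.max 0 (Num.min y 1)))).
    move=> y; rewrite inE/= in_itv/= => /andP[y0 y1].
    by rewrite min_l// max_r.
  apply: nondecreasing_measurable => // y z yz; apply: f_nd => //.
  rewrite ge_max !le_max lexx/=; apply/orP; right.
  by rewrite le_min !ge_min yz lexx orbT.
exists 1 => y; rewrite patchE; case: ifPn => [|_]; last by rewrite normr0.
rewrite inE/= => /f01; rewrite in_itv/= => /andP[f0 f1].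
by rewrite ger0_norm.
Qed.

(** * Strata *)

Lemma strata_le (R : realType) (K : nat) (x : nat -> R) (i j : nat) :
  is_strata K x -> (i <= j <= K)%N -> x i <= x j.
Proof.
move=> [_ _ xS] /andP[]; elim: j => [|j IH]; first by rewrite leqn0 => /eqP ->.
rewrite leq_eqVlt => /predU1P[-> //|ij jK].
by rewrite (le_trans (IH ij (ltnW jK)))// ltW// xS.
Qed.

Lemma strata_in01 (R : realType) (K : nat) (x : nat -> R) (i : nat) :
  is_strata K x -> (i <= K)%N -> x i \in `[0, 1].
Proof.
move=> hx iK; have [x0 x1 _] := hx.
by rewrite in_itv/= -{1}x0 -{1}x1 !(strata_le hx)// ?leq0n ?iK ?leqnn.
Qed.

Lemma Rintegral_strata (R : realType) (K : nat) (x : nat -> R) (g : R -> R) :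
  is_strata K x -> bounded_measurable g ->
  \sum_(k < K) \int[@lebesgue_measure R]_(y in `[x k, x k.+1]) g y =
  \int[@lebesgue_measure R]_(y in `[0, 1]) g y.
Proof.
move=> hx bg; have [x0 xK _] := hx.
suff telescope j : (j <= K)%N ->
    \sum_(k < j) \int[@lebesgue_measure R]_(y in `[x k, x k.+1]) g y =
    \int[@lebesgue_measure R]_(y in `[x 0%N, x j]) g y.
  by rewrite telescope// x0 xK.
elim: j => [|j IH] jK; first by rewrite big_ord0 set_itv1 Rintegral_set1.
rewrite big_ord_recr/= IH ?(ltnW jK)//; apply/eqP.
rewrite eq_sym addrC -subr_eq; apply/eqP.
rewrite Rintegral_itvB ?Rintegral_itv_obnd_cbnd ?bnd_simp//.
- exact: integrable_lebesgue_itv.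
- exact: integrable_lebesgue_itv.
- by rewrite (strata_le hx)// leq0n ltnW.
- by rewrite (strata_le hx)// leqnSn.
Qed.

Lemma stratum_ratio_ge0 (R : realType) (K : nat) (x : nat -> R)
  (m : 'I_K -> nat) (k : 'I_K) : 0 <= stratum_ratio x m k.
Proof. by rewrite divr_ge0 ?sqr_ge0. Qed.

(** * The mean square error of the stratified estimator *)

Lemma sqr_sub_midpoint_le (R : realFieldType) (a b u : R) :
  a <= u <= b -> (u - (a + b) / 2) ^+ 2 <= ((b - a) / 2) ^+ 2.
Proof.
move=> /andP[au ub].
rewrite -[leLHS]real_normK ?num_real//.
rewrite ler_pXn2r ?nnegrE ?divr_ge0 ?subr_ge0 ?(le_trans au)//.
rewrite ler_norml lerBlDr lerBrDr -mulNr -!mulrDl.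
have -> : - (b - a) + (a + b) = a * 2.
  by rewrite opprB addrACA [- b + b]addNr addr0 mulr_natr mulr2n.
have -> : b - a + (a + b) = b * 2.
  by rewrite addrA subrK mulr_natr mulr2n.
by rewrite !mulfK// au.
Qed.

Section stratified_error.
Context (R : realType) (n K : nat) (x : nat -> R) (m : 'I_K -> nat).
Hypotheses (hx : is_strata K x) (hm : is_allocation n m).

Let weight_gt0 (k : 'I_K) : 0 < weight x k.
Proof. by have [_ _ xS] := hx; rewrite subr_gt0 xS. Qed.

Let size_gt0 (k : 'I_K) : 0 < (m k)%:R :> R.
Proof. by rewrite ltr0n; exact: hm.1. Qed.

Let knot01 (k : nat) : (k <= K)%N -> x k \in `[0, 1].
Proof. exact: strata_in01. Qed.

Let stratum_sub01 (k : 'I_K) : `[x k, x k.+1] `<=` `[0, 1].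
Proof.
have /andP[xk0 _] : 0 <= x k <= 1 by have := knot01 (ltnW (ltn_ord k)); rewrite in_itv.
have /andP[_ xk1] : 0 <= x k.+1 <= 1 by have := knot01 (ltn_ord k); rewrite in_itv.
by apply: subset_itv; rewrite bnd_simp.
Qed.

(** The coefficient of each of the n_k samples of the stratum k is w_k / n_k,
and n_k (w_k / n_k)^2 = w_k^2 / n_k. *)
Lemma sum_samples (F : 'I_K -> R) :
  \sum_(j : {k : 'I_K & 'I_(m k)}) (weight x (tag j) / (m (tag j))%:R) ^+ 2 *
    F (tag j) = \sum_(k < K) stratum_ratio x m k * F k.
Proof.
rewrite -(@sig_big_dep _ _ _ _ (fun k => 'I_(m k)) xpredT (fun _ => xpredT)
  (fun k _ => (weight x k / (m k)%:R) ^+ 2 * F k))/=.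
apply: eq_bigr => k _; rewrite sumr_const card_ord -mulrnAl; congr (_ * _).
rewrite exprMn -mulrnAr /stratum_ratio; congr (_ * _).
by rewrite expr2 -mulr_natr -mulrA mulVf ?mulr1// gt_eqF.
Qed.

Context (d : measure_display) (T : measurableType d) (P : probability T R)
  (X : forall k : 'I_K, 'I_(m k) -> {RV P >-> R}).
Hypothesis hX : is_stratified_sample x X.

Lemma strat_estimatorE (f : R -> R) (t : T) :
  strat_estimator x X f t = \sum_(j : {k : 'I_K & 'I_(m k)})
    weight x (tag j) / (m (tag j))%:R *
    (f \_ `[0, 1]) (X (tagged j) t).
Proof.
rewrite -(@sig_big_dep _ _ _ _ (fun k => 'I_(m k)) xpredT (fun _ => xpredT)
  (fun k i => weight x k / (m k)%:R * (f \_ `[0, 1]) (X i t)))/=.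
by apply: eq_bigr => k _; rewrite mulrA mulr_sumr.
Qed.

Variable f : R -> R.
Hypothesis hf : monotone_class f.
Local Notation g := (f \_ `[0, 1]).

Let bg : bounded_measurable g.
Proof. exact: monotone_class_bounded_measurable. Qed.

Let g_ge0 y : 0 <= g y.
Proof.
rewrite patchE; case: ifPn => //; rewrite inE/= => /hf.2.
by rewrite in_itv/= => /andP[].
Qed.

Let gE (k : 'I_K) y : y \in `[x k, x k.+1] -> g y = f y.
Proof. by move=> /stratum_sub01 y01; rewrite patchE ifT// inE. Qed.

Let bgX (k : 'I_K) (i : 'I_(m k)) : bounded_measurable (fun t => g (X i t)).
Proof. by apply: bounded_measurable_comp => //; exact: measurable_funPT. Qed.

Lemma sample_mean (k : 'I_K) (i : 'I_(m k)) : \int[P]_t g (X i t) =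
  (weight x k)^-1 * \int[@lebesgue_measure R]_(y in `[x k, x k.+1]) f y.
Proof.
rewrite (Rintegral_uniform_on (hX.1 k i) bg g_ge0); congr (_ * _).
by apply: eq_Rintegral => y; rewrite inE/=; exact: gE.
Qed.

Lemma strat_estimator_unbiased :
  \sum_(j : {k : 'I_K & 'I_(m k)}) weight x (tag j) / (m (tag j))%:R *
    \int[P]_t g (X (tagged j) t) = true_integral f.
Proof.
rewrite -(@sig_big_dep _ _ _ _ (fun k => 'I_(m k)) xpredT (fun _ => xpredT)
  (fun k i => weight x k / (m k)%:R * \int[P]_t g (X i t)))/=.
rewrite [RHS](_ : _ = \int[@lebesgue_measure R]_(y in `[0, 1]) g y); last first.
  by apply: eq_Rintegral => y y01; rewrite patchE y01.
rewrite -(Rintegral_strata hx bg); apply: eq_bigr => k _.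
under eq_bigr do rewrite sample_mean.
rewrite sumr_const card_ord -[LHS]mulr_natl mulrA [_%:R * _]mulrCA.
rewrite mulfV ?gt_eqF// mulr1 mulVKf ?gt_eqF//.
by apply: eq_Rintegral => y; rewrite inE/= => /gE.
Qed.

Definition sample_variance (k : 'I_K) (i : 'I_(m k)) : R :=
  \int[P]_t (g (X i t) - \int[P]_s g (X i s)) ^+ 2.

Definition mean_square_error : R :=
  \int[P]_t (strat_estimator x X f t - true_integral f) ^+ 2.

Lemma mean_square_errorE : mean_square_error =
  \sum_(j : {k : 'I_K & 'I_(m k)})
    (weight x (tag j) / (m (tag j))%:R) ^+ 2 * sample_variance (tagged j).
Proof.
rewrite -[RHS](mean_square_error_independent
  (fun j : {k : 'I_K & 'I_(m k)} => weight x (tag j) / (m (tag j))%:R) hX.2 bg).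
rewrite strat_estimator_unbiased.
by apply: eq_Rintegral => t _; rewrite strat_estimatorE.
Qed.

Let bS : bounded_measurable (strat_estimator x X f).
Proof.
have /funext -> := strat_estimatorE f; apply: bounded_measurable_sum => j.
exact: (bounded_measurableM (bounded_measurable_cst _ _) (bgX _)).
Qed.

Lemma expectation_strat_estimator :
  \int[P]_t strat_estimator x X f t = true_integral f.
Proof.
rewrite -strat_estimator_unbiased.
under eq_Rintegral do rewrite strat_estimatorE.
rewrite Rintegral_sum; last first.
  by move=> j; exact: (bounded_measurableM (bounded_measurable_cst _ _) (bgX _)).
apply: eq_bigr => j _; rewrite RintegralZl//.
exact: (bounded_measurable_integrableP P (bgX _)).
Qed.

Lemma variance_strat_estimator :
  'V_P[strat_estimator x X f]%E = mean_square_error%:E.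
Proof. by rewrite variance_Rintegral// expectation_strat_estimator. Qed.

Lemma mean_square_error_ge0 : 0 <= mean_square_error.
Proof. by apply: Rintegral_ge0 => t _; exact: sqr_ge0. Qed.

Lemma L2_error_strat_estimator : L2_error P (strat_estimator x X) f =
  (Num.sqrt mean_square_error)%:E.
Proof.
rewrite /L2_error.
rewrite (_ : (fun t => _) =
    (fun t => (strat_estimator x X f t - true_integral f) ^+ 2)); last first.
  by apply/funext => t; rewrite distrC real_normK// num_real.
rewrite expectation_Rintegral; last first.
  exact: (bounded_measurableX2 (bounded_measurableB bS (bounded_measurable_cst _ _))).
by rewrite poweR12_sqrt// lee_fin; exact: mean_square_error_ge0.
Qed.

(** Popoviciu's inequality: replacing the mean by the middle c of the range
[f (x k), f (x k.+1)] only increases the mean square deviation, and every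
value of f on the stratum is within half the range of c. *)
Lemma sample_variance_le (k : 'I_K) (i : 'I_(m k)) :
  sample_variance i <= ((f (x k.+1) - f (x k)) / 2) ^+ 2.
Proof.
pose c := (f (x k) + f (x k.+1)) / 2.
have bgc : bounded_measurable (fun y => (g y - c) ^+ 2).
  exact: (bounded_measurableX2 (bounded_measurableB bg (bounded_measurable_cst _ _))).
rewrite /sample_variance (variance_about P c (bgX i)).
apply: le_trans (_ : \int[P]_t (g (X i t) - c) ^+ 2 <= _).
  by rewrite gerDl oppr_le0 sqr_ge0.
have uX := hX.1 k i.
rewrite (Rintegral_uniform_on uX bgc); last by move=> y; exact: sqr_ge0.
rewrite -/(weight x k) mulrC ler_pdivrMr//.
apply: le_trans (_ : \int[@lebesgue_measure R]_(y in `[x k, x k.+1])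
  ((f (x k.+1) - f (x k)) / 2) ^+ 2 <= _).
  apply: le_Rintegral => //.
  - exact: integrable_lebesgue_itv.
  - exact: (integrable_lebesgue_itv _ _ _ _ (bounded_measurable_cst _ _)).
  move=> y yk; rewrite (gE yk).
  have y01 := stratum_sub01 yk.
  move: yk; rewrite /= in_itv/= => /andP[xky yxk].
  have fl : f (x k) <= f y by apply: hf.1 => //; exact/knot01/ltnW.
  have fr : f y <= f (x k.+1) by apply: hf.1 => //; exact: knot01.
  by apply: sqr_sub_midpoint_le; rewrite fl.
rewrite Rintegral_cst//= lebesgue_measure_itv/= lte_fin.
by rewrite -subr_gt0 weight_gt0.
Qed.

(** The increments D k of f are nonnegative with sum at most 1, so each is at
most 1 and D k ^+ 2 <= D k: the weights D k ^+ 2 of the ratios have sum at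
most 1, and the weighted sum is at most the largest ratio. *)
Lemma mean_square_error_le : mean_square_error <= max_sq_error x m.
Proof.
rewrite mean_square_errorE.
pose D (k : nat) := f (x k.+1) - f (x k).
have D01 (k : 'I_K) : 0 <= D k <= 1.
  have xk := knot01 (ltnW (ltn_ord k)); have xk1 := knot01 (ltn_ord k).
  rewrite subr_ge0 (hf.1 _ _ xk xk1)/=; last by rewrite -subr_ge0 ltW// weight_gt0.
  have := hf.2 _ xk; have := hf.2 _ xk1; rewrite !in_itv/= => /andP[_ f1] /andP[f0 _].
  by rewrite lerBlDl (le_trans f1)// lerDr.
apply: (@le_trans _ _ (\sum_(k < K) stratum_ratio x m k * (D k / 2) ^+ 2)).
  rewrite -sum_samples; apply: ler_sum => j _.
  by rewrite ler_wpM2l ?sqr_ge0// sample_variance_le.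
have -> : \sum_(k < K) stratum_ratio x m k * (D k / 2) ^+ 2 =
    4^-1 * \sum_(k < K) stratum_ratio x m k * D k ^+ 2.
  rewrite mulr_sumr; apply: eq_bigr => k _.
  by rewrite exprMn mulrA [RHS]mulrC exprVn -natrX.
rewrite /max_sq_error ler_pM2l ?invr_gt0//.
set M := \big[Num.max/0]_(k < K) _.
have M0 : 0 <= M by exact: bigmax_ge_id.
apply: (@le_trans _ _ (\sum_(k < K) M * D k)).
  apply: ler_sum => k _; have /andP[D0 D1] := D01 k.
  apply: ler_pM => //; [exact: stratum_ratio_ge0|exact: sqr_ge0| |].
    exact: le_bigmax.
  by rewrite expr2 ler_piMr.
rewrite -mulr_sumr ler_piMr// -(big_mkord xpredT D) telescope_sumr//.
have := hf.2 _ (knot01 (leqnn K)); have := hf.2 _ (knot01 (leq0n K)).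
rewrite !in_itv/= => /andP[f0 _] /andP[_ f1].
by rewrite lerBlDl (le_trans f1)// lerDr.
Qed.

End stratified_error.

Lemma unit_step_monotone_class (R : realType) (a : R) :
  monotone_class (unit_step a).
Proof.
split => [y z _|y _]; last first.
  by rewrite in_itv/= /unit_step indicE; case: (_ \in _); rewrite /= ?ler01 ?lexx.
rewrite in_itv/= => /andP[_ z1] yz; rewrite /unit_step !indicE ler_nat.
case: (boolP (y \in _)) => //; rewrite inE/= in_itv/= => /andP[ay _].
by rewrite mem_set//= in_itv/= z1 (le_trans ay).
Qed.

(** * The worst case: a unit step at the middle of a stratum *)

Section unit_step_error.
Context (R : realType) (n K : nat) (x : nat -> R) (m : 'I_K -> nat).
Hypotheses (hx : is_strata K x) (hm : is_allocation n m).

Lemma max_sq_errorE (ks : 'I_K) :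
  (forall k, stratum_ratio x m k <= stratum_ratio x m ks) ->
  max_sq_error x m = 4^-1 * stratum_ratio x m ks.
Proof.
move=> ks_max; congr (_ * _); apply/eqP; rewrite eq_le le_bigmax andbT.
by apply: bigmax_le => [|k _ //]; exact: stratum_ratio_ge0.
Qed.

Context (d : measure_display) (T : measurableType d) (P : probability T R)
  (X : forall k : 'I_K, 'I_(m k) -> {RV P >-> R}).
Hypothesis hX : is_stratified_sample x X.

Lemma unit_step_midpoint_mean (k : 'I_K) :
  (weight x k)^-1 * \int[@lebesgue_measure R]_(y in `[x k, x k.+1])
    unit_step (midpoint x k) y = 2^-1.
Proof.
have [_ _ xS] := hx; have xk := xS k (ltn_ord k).
have /andP[_ xk1] : 0 <= x k.+1 <= 1.
  by have := strata_in01 hx (ltn_ord k); rewrite in_itv.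
have [kmid midk1] : x k < midpoint x k /\ midpoint x k < x k.+1.
  by split; rewrite midf_lt.
rewrite /Rintegral integral_indic//.
rewrite (_ : _ `&` _ = `[midpoint x k, x k.+1]%classic); last first.
  apply/seteqP; split => y /=; rewrite !in_itv/=.
    by move=> [/andP[-> _] /andP[_ ->]].
  move=> /andP[ay yk]; rewrite ay yk (le_trans yk xk1)//; split => //.
  by rewrite (le_trans (ltW kmid) ay).
rewrite /= lebesgue_measure_itv/= lte_fin midk1 -EFinB/=.
have -> : x k.+1 - midpoint x k = weight x k * 2^-1.
  rewrite /midpoint /weight.
  by rewrite {1}(splitr (x k.+1)) mulrDl opprD addrACA subrr addr0 -mulrBl.
by rewrite mulKf// gt_eqF// subr_gt0.
Qed.

(** The step takes the values 0 and 1, both at distance 1/2 from its mean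
1/2. *)
Lemma sample_variance_unit_step (k : 'I_K) (i : 'I_(m k)) :
  sample_variance X (unit_step (midpoint x k)) i = 4^-1.
Proof.
set f := unit_step _; have hf : monotone_class f := unit_step_monotone_class _.
have bg := monotone_class_bounded_measurable hf.
have bgX : bounded_measurable (fun t => (f \_ `[0, 1]) (X i t)).
  by apply: bounded_measurable_comp => //; exact: measurable_funPT.
have w0 : 0 < weight x k by have [_ _ xS] := hx; rewrite subr_gt0 xS.
rewrite /sample_variance (variance_about P 2^-1 bgX).
rewrite (sample_mean hx hX hf) unit_step_midpoint_mean subrr expr0n subr0.
have uX := hX.1 k i.
have bh : bounded_measurable (fun y => ((f \_ `[0, 1]) y - 2^-1) ^+ 2).
  exact: (bounded_measurableX2 (bounded_measurableB bg (bounded_measurable_cst _ _))).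
rewrite (Rintegral_uniform_on uX bh); last by move=> y; exact: sqr_ge0.
have halfN : 1 - 2^-1 = 2^-1 :> R.
  by rewrite [X in X - _](splitr 1) mul1r addrK.
have {}bh y : ((f \_ `[0, 1]) y - 2^-1) ^+ 2 = 4^-1.
  have -> : 4^-1 = (2^-1) ^+ 2 :> R by rewrite exprVn -natrX.
  rewrite patchE; case: ifPn => _; last by rewrite sub0r sqrrN.
  by rewrite /f /unit_step indicE; case: (_ \in _); rewrite /= ?sub0r ?sqrrN ?halfN.
under eq_Rintegral do rewrite bh.
rewrite Rintegral_cst//= lebesgue_measure_itv/= lte_fin -subr_gt0 w0/=.
by rewrite mulrC mulfK// gt_eqF.
Qed.

(** For the lower bound it is enough to keep the samples of the stratum ks,
the contributions of the other strata being nonnegative. *)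
Lemma mean_square_error_unit_step (ks : 'I_K) :
  (forall k, stratum_ratio x m k <= stratum_ratio x m ks) ->
  mean_square_error x X (unit_step (midpoint x ks)) = max_sq_error x m.
Proof.
move=> ks_max; have hf := unit_step_monotone_class (midpoint x ks).
apply/eqP; rewrite eq_le (mean_square_error_le hx hm hX hf)/=.
rewrite (mean_square_errorE hx hm hX hf) (max_sq_errorE ks_max).
pose F (k : 'I_K) : R := if k == ks then 4^-1 else 0.
have -> : 4^-1 * stratum_ratio x m ks = \sum_(k < K) stratum_ratio x m k * F k.
  rewrite (bigD1 ks)//= big1 ?addr0; first by rewrite /F eqxx mulrC.
  by move=> k /negbTE; rewrite /F => ->; rewrite mulr0.
rewrite -(sum_samples x hm); apply: ler_sum => -[k i] _.
rewrite ler_wpM2l ?sqr_ge0//= /F; case: eqP => [->|_] in i *.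
  by rewrite sample_variance_unit_step.
by apply: Rintegral_ge0 => t _; exact: sqr_ge0.
Qed.

Lemma e2_strat_estimator (ks : 'I_K) :
  (forall k, stratum_ratio x m k <= stratum_ratio x m ks) ->
  e2 P (strat_estimator x X) = (Num.sqrt (max_sq_error x m))%:E.
Proof.
move=> ks_max; apply/eqP; rewrite eq_le; apply/andP; split.
  apply: ge_ereal_sup => _ [f hf <-].
  rewrite (L2_error_strat_estimator x X hf) lee_fin.
  by apply: ler_wsqrtr; exact: (mean_square_error_le hx hm hX hf).
have hf := unit_step_monotone_class (midpoint x ks).
rewrite -(mean_square_error_unit_step ks_max).
rewrite -(L2_error_strat_estimator x X hf).
by apply: ereal_sup_ubound; exists (unit_step (midpoint x ks)).
Qed.

End unit_step_error.

(** * Optimal strata *)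

Section optimal_strata.
Context (R : realType) (n : nat).
Hypothesis n_gt0 : (0 < n)%N.

(** With M the largest ratio, w_k^2 <= M n_k <= M n_k^2 since n_k >= 1, so
w_k <= sqrt M n_k; summing over the strata, 1 <= sqrt M n. *)
Lemma max_sq_error_ge (K : nat) (x : nat -> R) (m : 'I_K -> nat) :
  is_strata K x -> is_allocation n m ->
  (4 * n%:R ^+ 2)^-1 <= max_sq_error x m.
Proof.
move=> hx hm; have [x0 xK xS] := hx.
rewrite /max_sq_error invfM ler_pM2l ?invr_gt0//.
set M := \big[Num.max/0]_(k < K) _.
have M0 : 0 <= M by exact: bigmax_ge_id.
have weight_le (k : 'I_K) : weight x k <= Num.sqrt M * (m k)%:R.
  have w0 : 0 <= weight x k by rewrite subr_ge0 ltW// xS.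
  have mk : 0 < (m k)%:R :> R by rewrite ltr0n; exact: hm.1.
  rewrite -(@ler_pXn2r _ 2) ?nnegrE ?mulr_ge0 ?sqrtr_ge0//.
  rewrite exprMn sqr_sqrtr// expr2 mulrA -ler_pdivrMr//.
  have : stratum_ratio x m k <= M by exact: le_bigmax.
  rewrite /stratum_ratio expr2 => /le_trans -> //.
  by rewrite ler_peMr// ler1n; exact: hm.1.
have n0 : 0 < n%:R :> R by rewrite ltr0n.
have : 1 <= Num.sqrt M * n%:R.
  rewrite [leLHS](_ : 1 = \sum_(k < K) weight x k); last first.
    by rewrite -(big_mkord xpredT (weight x)) telescope_sumr// x0 xK subr0.
  by rewrite -hm.2 natr_sum mulr_sumr; exact: ler_sum.
rewrite -ler_pdivrMr// div1r => sqrtM.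
by rewrite -exprVn -[leRHS]sqr_sqrtr// ler_pXn2r ?nnegrE ?invr_ge0 ?sqrtr_ge0.
Qed.

Let x_eq := fun k : nat => k%:R / n%:R : R.
Let m_eq := fun _ : 'I_n => 1%N.

Lemma equal_strata : is_strata n x_eq.
Proof.
split; rewrite /x_eq ?mul0r ?divff ?pnatr_eq0 -?lt0n// => k _.
by rewrite ltr_pM2r ?invr_gt0 ?ltr0n// ltr_nat.
Qed.

Lemma weight_equal_strata (k : nat) : weight x_eq k = n%:R^-1.
Proof. by rewrite /weight /x_eq -mulrBl -natrB ?subSnn ?mul1r. Qed.

Lemma unit_allocation : is_allocation n m_eq.
Proof. by split => //; rewrite sum1_card card_ord. Qed.

Lemma max_sq_error_equal_strata :
  max_sq_error x_eq m_eq = (4 * n%:R ^+ 2)^-1.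
Proof.
apply/eqP; rewrite eq_le max_sq_error_ge ?andbT//;
  [|exact: equal_strata|exact: unit_allocation].
rewrite invfM ler_pM2l ?invr_gt0//.
apply: bigmax_le => [|k _]; first by rewrite invr_ge0 sqr_ge0.
by rewrite /stratum_ratio weight_equal_strata divr1 exprVn.
Qed.

End optimal_strata.

Theorem theorem4p1 (R : realType) (n : nat) (hn : (1 <= n)%N) :
  (forall (K : nat) (hK : (1 <= K <= n)%N)
     (x : nat -> R) (hx : is_strata K x)
     (m : 'I_K -> nat) (hm : is_allocation n m)
     (d : measure_display) (T : measurableType d) (P : probability T R)
     (X : forall k : 'I_K, 'I_(m k) -> {RV P >-> R})
     (hX : is_stratified_sample x X),
     [/\ (e2 P (strat_estimator x X) ^+ 2)%E = (max_sq_error x m)%:E,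
         is_maximum [set 'V_P[strat_estimator x X f]%E | f in @monotone_class R]
           (max_sq_error x m)%:E
       & forall ks : 'I_K,
           (forall k, stratum_ratio x m k <= stratum_ratio x m ks) ->
           let f := unit_step (midpoint x ks) in
           [/\ monotone_class f,
               L2_error P (strat_estimator x X) f
                 = e2 P (strat_estimator x X)
             & 'V_P[strat_estimator x X f]%E = (max_sq_error x m)%:E]])
  /\ is_minimum
       [set v : R | exists (K : nat) (x : nat -> R) (m : 'I_K -> nat),
          [/\ (1 <= K <= n)%N, is_strata K x, is_allocation n m
            & v = max_sq_error x m]]
       (4 * n%:R ^+ 2)^-1
  /\ (let x := fun k : nat => k%:R / n%:R : R in
      let m := fun _ : 'I_n => 1%N in
      [/\ is_strata n x,
          forall k : 'I_n, weight x k = n%:R^-1,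
          is_allocation n m
        & max_sq_error x m = (4 * n%:R ^+ 2)^-1]).
Proof.
have hE := equal_strata R hn; have hU := unit_allocation n.
have hV := max_sq_error_equal_strata R hn.
split; last split.
- move=> K /andP[K1 _] x hx m hm d T P X hX.
  have at_step (ks : 'I_K) :
      (forall k, stratum_ratio x m k <= stratum_ratio x m ks) ->
      let f := unit_step (midpoint x ks) in
      [/\ monotone_class f,
          L2_error P (strat_estimator x X) f = e2 P (strat_estimator x X)
        & 'V_P[strat_estimator x X f]%E = (max_sq_error x m)%:E].
    move=> ks_max f; have hf : monotone_class f by exact: unit_step_monotone_class.
    have fE := mean_square_error_unit_step hx hm hX ks_max.
    split => //.
      by rewrite (L2_error_strat_estimator x X hf) fE
        (e2_strat_estimator hx hm hX ks_max).
    by rewrite (variance_strat_estimator hx hm hX hf) fE.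
  have [ks ks_max] : exists ks : 'I_K,
      forall k, stratum_ratio x m k <= stratum_ratio x m ks.
    case: (arg_maxP (stratum_ratio x m) (i0 := Ordinal K1) (P := xpredT)) => //.
    by move=> ks _ ks_max; exists ks => k; exact: ks_max.
  have [hf _ varf] := at_step ks ks_max.
  split => //.
    rewrite (e2_strat_estimator hx hm hX ks_max) -EFin_expe sqr_sqrtr//.
    by rewrite mulr_ge0// bigmax_ge_id.
  split; first by exists (unit_step (midpoint x ks)).
  move=> _ [f hf' <-].
  rewrite (variance_strat_estimator hx hm hX hf') lee_fin.
  exact: (mean_square_error_le hx hm hX hf').
- split; first by exists n, (fun k => k%:R / n%:R), (fun=> 1%N); rewrite hn leqnn.
  by move=> _ [K [x [m [_ hx hm ->]]]]; exact: max_sq_error_ge.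
- by split => // k; exact: weight_equal_strata.
Qed.
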